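(* Let $\{A,B,C\}\subset S^{1,1}$ be a non-contractible spatiolateral de Sitter triangle with side lengths $a,b,c$ opposite $A,B,C$ and angles $\alpha,\beta,\gamma$ at $A,B,C$, respectively. Then $$\frac{\sinh(\alpha)}{\sin(a)}=\frac{\sinh(\beta)}{\sin(b)}=\frac{\sinh(\gamma)}{\sin(c)}.$$
   Context: On $\mathbb{R}^3$ let $\langle\langle x,y\rangle\rangle=-x_1y_1+x_2y_2+x_3y_3$, $|||x|||=\sqrt{|\langle\langle x,x\rangle\rangle|}$, and let $\times$ be the Euclidean cross product. $S^{1,1}=\{x:\langle\langle x,x\rangle\rangle=1\}$. A two-dimensional linear subspace is spacelike if $\langle\langle\cdot,\cdot\rangle\rangle$ restricted to it is positive definite. For $A,B\in S^{1,1}$ with $A\ne\pm B$, the side between $A$ and $B$ is spacelike if $\operatorname{span}(A,B)$ is spacelike (equivalently $|\langle\langle A,B\rangle\rangle|<1$); its length is then $\arccos(\langle\langle A,B\rangle\rangle)\in(0,\pi)$, and the unit tangent vector at $A$ towards $B$ is $X_{AB}=\dfrac{B-\langle\langle A,B\rangle\rangle A}{|||A\times B|||}$. A spatiolateral triangle is a set of three distinct points $\{A,B,C\}\subset S^{1,1}$ all of whose sides are spacelike. It is contractible if, after projecting the vertices to the $(x_2,x_3)$-plane, there is a line through the origin such that all three projected points lie on one side of the line; otherwise it is non-contractible. Side lengths: $a$ between $B$ and $C$, $b$ between $A$ and $C$, $c$ between $A$ and $B$. The angle at $A$ is $\alpha=\operatorname{arcosh}(|\langle\langle X_{AB},X_{AC}\rangle\rangle|)\ge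 0$, and analogously $\beta$ at $B$, $\gamma$ at $C$. *)

(* Defs.v *)
From mathcomp Require Import all_boot all_order all_algebra.
From mathcomp Require Import all_classical all_reals all_analysis.

Set Implicit Arguments.
Unset Strict Implicit.
Unset Printing Implicit Defensive.

Import Order.TTheory GRing.Theory Num.Theory.

Local Open Scope ring_scope.

Definition sinh (R : realType) (x : R) : R := (expR x - expR (- x)) / 2.

Definition cosh (R : realType) (x : R) : R := (expR x + expR (- x)) / 2.

(* The logarithmic formula for the inverse of cosh : [0, +oo[ -> [1, +oo[;
   see arcosh_ge0 and arcoshK. The value is meaningful only for 1 <= x. *)
Definition arcosh (R : realType) (x : R) : R := ln (x + Num.sqrt (x ^+ 2 - 1)).

Lemma arcosh_ge0 (R : realType) (x : R) : 1 <= x -> 0 <= arcosh x.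
Proof. by move=> x1; apply: ln_ge0; rewrite ler_wpDr // sqrtr_ge0. Qed.

Lemma arcoshK (R : realType) (x : R) : 1 <= x -> cosh (arcosh x) = x.
Proof.
move=> x1; have s0 : 0 <= x ^+ 2 - 1 by rewrite subr_ge0 expr_ge1 // (le_trans ler01).
have t0 : 0 < x + Num.sqrt (x ^+ 2 - 1).
  by rewrite ltr_wpDr ?sqrtr_ge0 // (lt_le_trans ltr01).
rewrite /cosh /arcosh expRN lnK ?posrE //.
have -> : (x + Num.sqrt (x ^+ 2 - 1))^-1 = x - Num.sqrt (x ^+ 2 - 1).
  apply: (mulfI (lt0r_neq0 t0)); rewrite divff ?lt0r_neq0 //.
  by rewrite mulrC -subr_sqr sqr_sqrtr // opprB addrC subrK.
by rewrite addrACA subrr addr0 -mulr2n -[x *+ 2]mulr_natr mulfK // pnatr_eq0.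
Qed.

(* Vectors of R^3 are row vectors indexed from 0: the coordinates x_1, x_2, x_3
   are x 0 0, x 0 1, x 0 2. *)

Definition lorentz (R : realType) (x y : 'rV[R]_3) : R :=
  - (x 0 0 * y 0 0) + x 0 1 * y 0 1 + x 0 2 * y 0 2.

Definition lnorm (R : realType) (x : 'rV[R]_3) : R :=
  Num.sqrt `|lorentz x x|.

(* The Euclidean cross product, not the Lorentzian one. *)
Definition crossmul (R : realType) (x y : 'rV[R]_3) : 'rV[R]_3 :=
  \row_(i < 3) [:: x 0 1 * y 0 2 - x 0 2 * y 0 1;
                   x 0 2 * y 0 0 - x 0 0 * y 0 2;
                   x 0 0 * y 0 1 - x 0 1 * y 0 0]`_i.

Definition de_sitter (R : realType) : set 'rV[R]_3 :=
  [set x | lorentz x x = 1].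

Definition spacelike_plane (R : realType) (U : {vspace 'rV[R]_3}) : Prop :=
  \dim U = 2%N /\ forall v, v \in U -> v != 0 -> 0 < lorentz v v.

Definition spacelike_side (R : realType) (A B : 'rV[R]_3) : Prop :=
  [/\ A <> B, A <> - B & spacelike_plane <<[:: A; B]>>%VS].

Definition side_length (R : realType) (A B : 'rV[R]_3) : R :=
  acos (lorentz A B).

Definition unit_tangent (R : realType) (A B : 'rV[R]_3) : 'rV[R]_3 :=
  (lnorm (crossmul A B))^-1 *: (B - lorentz A B *: A).

(* The angle at the vertex A of the triangle {A, B, C}. *)
Definition angle_at (R : realType) (A B C : 'rV[R]_3) : R :=
  arcosh `|lorentz (unit_tangent A B) (unit_tangent A C)|.

Definition spatiolateral_triangle (R : realType) (A B C : 'rV[R]_3) : Prop :=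
  [/\ [/\ de_sitter A, de_sitter B & de_sitter C],
      [/\ A <> B, A <> C & B <> C] &
      [/\ spacelike_side A B, spacelike_side A C & spacelike_side B C]].

(* Projection to the (x_2, x_3)-plane. *)
Definition proj23 (R : realType) (x : 'rV[R]_3) : 'rV[R]_2 :=
  \row_(i < 2) [:: x 0 1; x 0 2]`_i.

(* The line through the origin is the orthogonal complement of n <> 0, and n
   points to the (open) side of it that contains the projected vertices. *)
Definition contractible (R : realType) (A B C : 'rV[R]_3) : Prop :=
  exists n : 'rV[R]_2, n != 0 /\
    {in [:: A; B; C], forall P, 0 < \sum_(i < 2) n 0 i * proj23 P 0 i}.

(* Main.v *)
Require Import Defs.
From mathcomp Require Import all_boot all_order all_algebra.
From mathcomp Require Import all_classical all_reals all_analysis.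
From mathcomp Require Import ring.

Import Order.TTheory GRing.Theory Num.Theory.

Local Open Scope ring_scope.

(** Write x, y, z for the Lorentz products of the vertices.  The side opposite
    A has sine [sqrt (1 - x^2)], which is also the Lorentz norm of [B × C], and
    the tangent vectors at A have product [k = (x - y z) / (sin b * sin c)].
    Then [k^2 - 1 = E / (sin b * sin c)^2], where E, minus the Gram determinant
    of A, B, C, is the square of det (A, B, C), hence nonnegative and symmetric
    in the vertices.  So [sinh alpha / sin a = sqrt E / (sin a * sin b * sin c)]. *)

(** Since [arcosh x] is nonnegative, so is its [sinh], and [cosh ^ 2 - sinh ^ 2 = 1] fixes the
    value. *)
Lemma sinh_arcosh {R : realType} (x : R) :
  1 <= x -> sinh (arcosh x) = Num.sqrt (x ^+ 2 - 1).
Proof.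
move=> x1; have ch := arcoshK x1.
have s0 : 0 <= sinh (arcosh x).
  by rewrite /sinh divr_ge0 // subr_ge0 ler_expR ge0_cp // arcosh_ge0.
rewrite -(ger0_norm s0) -sqrtr_sqr; congr Num.sqrt.
rewrite -[X in X ^+ 2 - 1]ch /sinh /cosh.
have e : expR (arcosh x) * expR (- arcosh x) = 1 by rewrite expRxMexpNx_1.
(* With [1] written as the product of the two exponentials, the goal is an identity in two
   independent variables. *)
by rewrite -[X in _ ^+ 2 - X]e; field.
Qed.

Lemma lorentzC {R : realType} (x y : 'rV[R]_3) : lorentz x y = lorentz y x.
Proof. by rewrite /lorentz; ring. Qed.

Lemma lorentzZZ {R : realType} (s t : R) (x y : 'rV[R]_3) :
  lorentz (s *: x) (t *: y) = s * t * lorentz x y.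
Proof. by rewrite /lorentz !mxE; ring. Qed.

Lemma lorentz_subZ {R : realType} (s t : R) (A x y : 'rV[R]_3) :
  lorentz (x - s *: A) (y - t *: A) =
  lorentz x y - t * lorentz x A - s * lorentz A y + s * t * lorentz A A.
Proof. by rewrite /lorentz !mxE; ring. Qed.

(** Lorentzian Lagrange identity. The Euclidean cross product serves because it differs from the
    Lorentzian one by the isometry [diag(-1, 1, 1)], whose determinant [-1] reverses the Euclidean
    sign. *)
Lemma lorentz_crossmul {R : realType} (x y : 'rV[R]_3) :
  lorentz (crossmul x y) (crossmul x y) =
  lorentz x y ^+ 2 - lorentz x x * lorentz y y.
Proof. by rewrite /lorentz !mxE /=; ring. Qed.

Definition neg_gram {R : realType} (A B C : 'rV[R]_3) : R :=
  lorentz B C ^+ 2 + lorentz A C ^+ 2 + lorentz A B ^+ 2 - 1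
  - 2 * lorentz B C * lorentz A C * lorentz A B.

(** If [M] has rows [A], [B], [C] and [J = diag(-1, 1, 1)], the Gram matrix is [M J M^T], of
    determinant [- (det M) ^ 2]. *)
Lemma neg_gram_ge0 {R : realType} (A B C : 'rV[R]_3) :
  de_sitter A -> de_sitter B -> de_sitter C -> 0 <= neg_gram A B C.
Proof.
rewrite /de_sitter /= => hA hB hC.
suff -> : neg_gram A B C = (\sum_i A 0 i * crossmul B C 0 i) ^+ 2.
  exact: sqr_ge0.
(* Restoring the factors equal to [1] gives an identity valid for all coordinates, hence within
   reach of [ring]. *)
transitivity (lorentz A A * lorentz B C ^+ 2 + lorentz B B * lorentz A C ^+ 2
  + lorentz C C * lorentz A B ^+ 2 - lorentz A A * lorentz B B * lorentz C C
  - 2 * lorentz B C * lorentz A C * lorentz A B).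
  by rewrite hA hB hC /neg_gram; ring.
rewrite !big_ord_recl big_ord0 /lorentz !mxE /=.
have -> : lift ord0 ord0 = 1 :> 'I_3 by apply: val_inj.
have -> : lift ord0 (lift ord0 ord0) = 2 :> 'I_3 by apply: val_inj.
by ring.
Qed.

(** The quantity is the Lorentz square of the component of [B] orthogonal to [A], a vector of the
    spacelike plane. *)
Lemma spacelike_side_lt1 {R : realType} (A B : 'rV[R]_3) :
  de_sitter A -> de_sitter B -> spacelike_side A B -> 0 < 1 - lorentz A B ^+ 2.
Proof.
rewrite /de_sitter /= => hA hB [AB ANB [_ pos]].
set z := lorentz A B.
have -> : 1 - z ^+ 2 = lorentz (B - z *: A) (B - z *: A).
  by rewrite lorentz_subZ hA hB (lorentzC B A) -/z; ring.
apply: pos.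
  by rewrite rpredB ?rpredZ // memv_span // !inE eqxx ?orbT.
(* If that component vanished, [B = z *: A] with [z ^ 2 = 1], so [B] would be [A] or [- A]. *)
apply/negP; rewrite subr_eq0 => /eqP BE.
have /eqP : z ^+ 2 = 1 by move: hB; rewrite BE lorentzZZ hA mulr1.
rewrite sqrf_eq1 => /orP[] /eqP z1; move: BE; rewrite z1.
  by rewrite scale1r => /esym.
by rewrite scaleN1r => BE; apply: ANB; rewrite BE opprK.
Qed.

Lemma sin_side_length {R : realType} (A B : 'rV[R]_3) :
  0 < 1 - lorentz A B ^+ 2 ->
  sin (side_length A B) = Num.sqrt (1 - lorentz A B ^+ 2).
Proof.
move=> h; apply: sin_acos; rewrite -ler_norml -(@ler_pXn2r _ 2) ?nnegrE //.
by rewrite real_normK ?num_real // expr1n -subr_ge0 ltW.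
Qed.

Lemma lnorm_crossmul {R : realType} (A B : 'rV[R]_3) :
  de_sitter A -> de_sitter B -> 0 < 1 - lorentz A B ^+ 2 ->
  lnorm (crossmul A B) = Num.sqrt (1 - lorentz A B ^+ 2).
Proof.
rewrite /de_sitter /= => hA hB h.
by rewrite /lnorm lorentz_crossmul hA hB mulr1 distrC gtr0_norm.
Qed.

Lemma sinh_angle_at {R : realType} (A B C : 'rV[R]_3) :
  de_sitter A -> de_sitter B -> de_sitter C ->
  0 < 1 - lorentz A B ^+ 2 -> 0 < 1 - lorentz A C ^+ 2 ->
  sinh (angle_at A B C) =
  Num.sqrt (neg_gram A B C) / (sin (side_length A B) * sin (side_length A C)).
Proof.
move=> hA hB hC hAB hAC; rewrite !sin_side_length //.
rewrite /angle_at /unit_tangent !lnorm_crossmul //.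
rewrite lorentzZZ lorentz_subZ (lorentzC B A) hA.
set z := lorentz A B in hAB *; set y := lorentz A C in hAC *.
set s := Num.sqrt (1 - z ^+ 2); set t := Num.sqrt (1 - y ^+ 2).
have s0 : 0 < s by rewrite sqrtr_gt0.
have t0 : 0 < t by rewrite sqrtr_gt0.
have s2 : s ^+ 2 = 1 - z ^+ 2 by rewrite sqr_sqrtr // ltW.
have t2 : t ^+ 2 = 1 - y ^+ 2 by rewrite sqr_sqrtr // ltW.
set k := (X in `|X|).
have kE : k ^+ 2 - 1 = neg_gram A B C / (s * t) ^+ 2.
  apply: (mulIf (x := (s * t) ^+ 2)).
    by rewrite expf_neq0 // mulf_neq0 ?gt_eqF.
  rewrite divfK ?expf_neq0 ?mulf_neq0 ?gt_eqF //.
  (* Uses [(x - y z) ^ 2 - (1 - z ^ 2) (1 - y ^ 2) = neg_gram A B C], where [x = lorentz B C]. *)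
  rewrite mulrBl mul1r -exprMn [k * _](_ : _ = lorentz B C - y * z).
    by rewrite exprMn s2 t2 /neg_gram -/y -/z; ring.
  by rewrite /k; field; rewrite !gt_eqF.
(* This puts the argument of [arcosh] in the range where [sinh_arcosh] applies. *)
have k1 : 1 <= `|k|.
  rewrite -(@ler_pXn2r _ 2) ?nnegrE // real_normK ?num_real // expr1n.
  by rewrite -subr_ge0 kE divr_ge0 ?neg_gram_ge0 ?sqr_ge0.
rewrite sinh_arcosh // real_normK ?num_real // kE.
rewrite sqrtrM ?neg_gram_ge0 // sqrtrV ?sqr_ge0 // sqrtr_sqr.
by rewrite gtr0_norm // mulr_gt0.
Qed.

Theorem theorem5p11 (R : realType) (A B C : 'rV[R]_3) (a b c alpha beta gamma : R)
    (triABC : spatiolateral_triangle A B C)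
    (ncABC : ~ contractible A B C)
    (def_a : a = side_length B C)
    (def_b : b = side_length A C)
    (def_c : c = side_length A B)
    (def_alpha : alpha = angle_at A B C)
    (def_beta : beta = angle_at B A C)
    (def_gamma : gamma = angle_at C A B) :
  sinh alpha / sin a = sinh beta / sin b /\
  sinh beta / sin b = sinh gamma / sin c.
Proof.
case: triABC => -[hA hB hC] _ [sAB sAC sBC].
have hAB := spacelike_side_lt1 _ _ hA hB sAB.
have hAC := spacelike_side_lt1 _ _ hA hC sAC.
have hBC := spacelike_side_lt1 _ _ hB hC sBC.
have sideC P Q : side_length P Q = side_length Q P :> R.
  by rewrite /side_length lorentzC.
have gB : neg_gram B A C = neg_gram A B C.
  by rewrite /neg_gram (lorentzC B A); ring.
have gC : neg_gram C A B = neg_gram A B C.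
  by rewrite /neg_gram (lorentzC C A) (lorentzC C B); ring.
rewrite def_alpha def_beta def_gamma def_a def_b def_c.
rewrite !sinh_angle_at // 1?(lorentzC B A) 1?(lorentzC C A) 1?(lorentzC C B) //.
rewrite gB gC (sideC B A) (sideC C A) (sideC C B).
by rewrite -!mulrA -!invfM; split; congr (_ / _); ring.
Qed.
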